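(* Let $\mathbb{F}$ be an algebraically closed field of characteristic $p>2$. Let $(V,[\cdot,\cdot]_V,\alpha_V,B_V)$ be a restricted involutive quadratic Hom-Lie algebra over $\mathbb{F}$ with $p$-structure $[p]_V$, and let $\mathscr{D}\in\mathrm{Der}_{\alpha_V}(V)$ be a restricted derivation with the $p$-property, with data $\xi\in\mathbb{F}$, $a_0\in V$ ($\mathscr{D}^p=\xi\mathscr{D}\circ\alpha_V^{p-1}+\mathrm{ad}_V(a_0)\circ\alpha_V^{p-1}$, $\mathscr{D}(a_0)=0$), such that $B_V$ is $\mathscr{D}$-invariant. Let $x_0\in V$, $\lambda_0\in\mathbb{F}$ satisfy, with $\lambda=1$: $\lambda\mathscr{D}+\mathrm{ad}_V(x_0)=\mathscr{D}$, $\alpha_V(\mathscr{D}(x_0))=-\mathscr{D}(x_0)$, $\alpha_V\circ\mathscr{D}^2-\mathscr{D}^2\circ\alpha_V=\mathrm{ad}_V(\mathscr{D}(x_0))$. Let $L=\mathbb{F}e^*\oplus V\oplus\mathbb{F}e$ with skew-symmetric bracket $[x,y]=[x,y]_V+B_V(\mathscr{D}x,y)e$, $[e^*,x]=-[x,e^*]=\mathscr{D}(x)$ ($x,y\in V$), $[e^*,e^*]=0$, $e$ central, and twist $\alpha(x)=\alpha_V(x)+B_V(x_0,x)e$, $\alpha(e^* )=e^*+x_0+\lambda_0e$, $\alpha(e)=e$. Let $l,m\in\mathbb{F}$, let $u_0\in\mathfrak z(V)$ with $\mathscr{D}(u_0)=0$, and let $\mathscr{P}:V\to\mathbb{F}$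 satisfy $\mathscr{P}(\gamma u)=\gamma^p\mathscr{P}(u)$ and $\mathscr{P}(u+v)=\mathscr{P}(u)+\mathscr{P}(v)+\sum_{i=1}^{p-1}\eta_i^V(u,v)$ for all $u,v\in V$, $\gamma\in\mathbb{F}$. Then the map defined by $u^{[p]_L}=u^{[p]_V}+\mathscr{P}(u)e$ ($u\in V$), $(e^* )^{[p]_L}=a_0+le+\xi e^*$, $e^{[p]_L}=me+u_0$ (and extended to $L$ by the axioms) is a $p$-structure on $(L,[\cdot,\cdot],\alpha)$, extending $[p]_V$.
   Context: Hom-Lie algebra: $(\mathfrak g,[\cdot,\cdot],\alpha)$ with $[x,y]=-[y,x]$, $[\alpha(x),[y,z]]+[\alpha(y),[z,x]]+[\alpha(z),[x,y]]=0$, $\alpha([x,y])=[\alpha x,\alpha y]$; involutive: $\alpha^2=\mathrm{id}$; quadratic: symmetric nondegenerate bilinear $B$ with $B([x,y],z)=B(x,[y,z])$, $B(\alpha x,y)=B(x,\alpha y)$. $\mathfrak z(V)$ is the center. A $p$-structure on $\mathfrak g$ is a map $x\mapsto x^{[p]}$ with (R1) $\mathrm{ad}(x^{[p]})\circ\alpha^{p-1}=\mathrm{ad}(\alpha^{p-1}x)\circ\mathrm{ad}(\alpha^{p-2}x)\circ\cdots\circ\mathrm{ad}(x)$; (R2) $(kx)^{[p]}=k^px^{[p]}$; (R3) $(x+y)^{[p]}=x^{[p]}+y^{[p]}+\sum_{i=1}^{p-1}s_i(x,y)$, where $\mathrm{ad}(\alpha^{p-2}(kx+y))\circ\cdots\circ\mathrm{ad}(kx+y)(x)=\sum_{i=1}^{p-1}is_i(x,y)k^{i-1}$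 for all $k$; restricted = with a $p$-structure. $\mathrm{Der}_{\alpha_V}(V)$: linear $\mathscr{D}$ with $\mathscr{D}\alpha_V=\alpha_V\mathscr{D}$, $\mathscr{D}[x,y]_V=[\mathscr{D}x,\alpha_Vy]_V+[\alpha_Vx,\mathscr{D}y]_V$; restricted: $\mathscr{D}(x^{[p]_V})=\mathrm{ad}_V(\alpha_V^{p-1}x)\circ\cdots\circ\mathrm{ad}_V(\alpha_Vx)(\mathscr{D}x)$; $p$-property: there are $\xi\in\mathbb{F}$, $a_0\in V$ with $\mathscr{D}^p=\xi\mathscr{D}\circ\alpha_V^{p-1}+\mathrm{ad}_V(a_0)\circ\alpha_V^{p-1}$, $\mathscr{D}(a_0)=0$. $B_V$ is $\mathscr{D}$-invariant if $B_V(\mathscr{D}x,y)+B_V(x,\mathscr{D}y)=0$. The scalars $\eta_i^V(u,v)$ are defined by $B_V\big(\mathscr{D}(\alpha_V^{p-2}(ku+v)),\mathrm{ad}_V(\alpha_V^{p-3}(ku+v))\circ\cdots\circ\mathrm{ad}_V(ku+v)(u)\big)=\sum_{i=1}^{p-1}i\eta_i^V(u,v)k^{i-1}$ for all $k\in\mathbb{F}$. *)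

(* Defs.v *)
From HB Require Import structures.
From mathcomp Require Import all_boot all_algebra.
Set Implicit Arguments. Unset Strict Implicit. Unset Printing Implicit Defensive.
Import GRing.Theory.
Local Open Scope ring_scope.

Section HomLie.
Variables (F : fieldType) (V : lmodType F).
Implicit Types (br : V -> V -> V) (al D : V -> V) (B : V -> V -> F).

Definition lin_map (f : V -> V) : Prop :=
  forall (a : F) (x y : V), f (a *: x + y) = a *: f x + f y.

Definition bilin_map br : Prop :=
  (forall (a : F) x y z, br (a *: x + y) z = a *: br x z + br y z) /\
  (forall (a : F) x y z, br z (a *: x + y) = a *: br z x + br z y).

Definition bilin_form B : Prop :=
  (forall (a : F) x y z, B (a *: x + y) z = a * B x z + B y z) /\
  (forall (a : F) x y z, B z (a *: x + y) = a * B z x + B z y).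

Definition hom_lie br al : Prop :=
  [/\ bilin_map br, lin_map al,
      (forall x y, br x y = - br y x),
      (forall x y z, br (al x) (br y z) + br (al y) (br z x)
                     + br (al z) (br x y) = 0)
    & (forall x y, al (br x y) = br (al x) (al y))].

Definition involutive_twist al : Prop := forall x, al (al x) = x.

Definition quadratic br al B : Prop :=
  [/\ bilin_form B, (forall x y, B x y = B y x),
      (forall x, (forall y, B x y = 0) -> x = 0),
      (forall x y z, B (br x y) z = B x (br y z))
    & (forall x y, B (al x) y = B x (al y))].

Fixpoint adchain br al (z : V) (n : nat) (y : V) : V :=
  match n with
  | 0 => y
  | n'.+1 => br (iter n' al z) (adchain br al z n' y)
  end.

(* p-structure (R1), (R2), (R3).  In (R3), s_i(x,y) (1 <= i <= p-1) are the
   elements determined by the polynomial identity in k. *)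
Definition p_structure (p : nat) br al (pm : V -> V) : Prop :=
  [/\ (forall x y, br (pm x) (iter p.-1 al y) = adchain br al x p y),
      (forall (k : F) x, pm (k *: x) = k ^+ p *: pm x)
    & (forall x y, exists s : nat -> V,
          (forall k : F, adchain br al (k *: x + y) p.-1 x
                         = \sum_(1 <= i < p) k ^+ i.-1 *: (s i *+ i))
          /\ pm (x + y) = pm x + pm y + \sum_(1 <= i < p) s i)].

Definition in_center br (u : V) : Prop := forall x, br u x = 0.

Definition hom_derivation br al D : Prop :=
  [/\ lin_map D, (forall x, D (al x) = al (D x))
    & (forall x y, D (br x y) = br (D x) (al y) + br (al x) (D y))].

Definition restricted_der (p : nat) br al (pm : V -> V) D : Prop :=
  forall x, D (pm x) = adchain br al (al x) p.-1 (D x).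

Definition p_property (p : nat) br al D (xi : F) (a0 : V) : Prop :=
  (forall x, iter p D x = xi *: D (iter p.-1 al x) + br a0 (iter p.-1 al x))
  /\ D a0 = 0.

Definition D_invariant B D : Prop := forall x y, B (D x) y + B x (D y) = 0.

(* eta_i^V(u,v), 1 <= i <= p-1, characterized by the polynomial identity *)
Definition eta_coeffs (p : nat) br al B D (u v : V) (eta : nat -> F) : Prop :=
  forall k : F,
    B (D (iter p.-2 al (k *: u + v))) (adchain br al (k *: u + v) p.-2 u)
    = \sum_(1 <= i < p) (eta i *+ i) * k ^+ i.-1.

End HomLie.

(* The extension L = F e* (+) V (+) F e, an element (a, u, b) standing for
   a e* + u + b e. *)
Section Extension.
Variables (F : fieldType) (V : lmodType F).

Definition Lsp : lmodType F := (F^o * V * F^o)%type.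

Definition estar : Lsp := (1, 0, 0).
Definition eL : Lsp := (0, 0, 1).
Definition incV (u : V) : Lsp := (0, u, 0).
End Extension.
Arguments estar {F V}.
Arguments eL {F V}.
Section Extension2.
Variables (F : fieldType) (V : lmodType F).

(* [a e* + u + b e, a' e* + u' + b' e]
     = a D u' - a' D u + [u,u']_V + B(D u, u') e   (bilinear extension) *)
Definition brL (brV : V -> V -> V) (B : V -> V -> F) (D : V -> V)
  (X Y : Lsp V) : Lsp V :=
  let: (a, u, _) := X in let: (a', u', _) := Y in
  (0, a *: D u' - a' *: D u + brV u u', B (D u) u').

Definition alL (alV : V -> V) (B : V -> V -> F) (x0 : V) (lambda0 : F)
  (X : Lsp V) : Lsp V :=
  let: (a, u, b) := X in
  (a, a *: x0 + alV u, a * lambda0 + B x0 u + b).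

End Extension2.

(* Main.v *)
(** Since [al] is, up to the center, an involution of L, the untwisted bracket
    [al [x, y]] makes L a Lie algebra for which (R1)-(R3) become the axioms of an
    ordinary restricted Lie algebra.  So one has to extend a p-map from the
    hyperplane V + F e to L when a p-th power of E = e* is given.  The p-map is
      (a E + u)^[p] = a^p E^[p] + u^[p] + s(a E, u),
    with s the sum of Jacobson's Lie polynomials.  Without an enveloping algebra,
    (R3) is obtained by differentiating k |-> (k x + y)^[p], a polynomial function
    of k with values in L: its derivative is ad(k x + y)^(p-1) x because in
    characteristic p the 1-form h |-> ad(x)^(p-1) h is closed.  (R1) follows in the
    same way from the derivative of k |-> ad(k x + y)^p z. *)

Require Import Defs.
From HB Require Import structures.
From mathcomp Require Import all_boot all_algebra.
From mathcomp Require Import ring zify.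
Import GRing.Theory.
Local Open Scope ring_scope.

Set Implicit Arguments. Unset Strict Implicit. Unset Printing Implicit Defensive.

(** * Polynomial functions of one variable and their formal derivatives *)

Section PolynomialFunctions.
Variables (F : closedFieldType) (M : lmodType F).
Implicit Types (c d : nat -> M) (f g : F -> M).

(** At a root t of [Q] the product of t and of all t^i - 1 is -1, so none of its factors
    vanishes. *)
Lemma non_unity_root_exists n :
  exists2 t : F, t != 0 & forall i, (0 < i < n)%N -> t ^+ i != 1.
Proof.
pose Q : {poly F} := 'X * \prod_(i < n | (0 < i)%N) ('X^i - 1) + 1.
have szQ : size Q != 1%N.
  have prod_monic : \prod_(i < n | (0 < i)%N) ('X^i - 1 : {poly F}) \is monic.
    by apply: monic_prod => i i_gt0; rewrite monicXnsubC.
  have szX := size_mulX (monic_neq0 prod_monic).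
  rewrite /Q mulrC size_polyDl szX ?size_poly1 ?eqSS ?ltnS ?lt0n;
    by rewrite size_poly_eq0 monic_neq0.
have /closed_rootP[t] := szQ.
rewrite rootE /Q !hornerE horner_prod addr_eq0 => /eqP tQ.
exists t.
  by apply/eqP => t0; move/eqP: tQ; rewrite t0 mul0r eq_sym oppr_eq0 oner_eq0.
move=> i /andP[i_gt0 lt_in]; apply/eqP => ti1.
move/eqP: tQ; rewrite (bigD1 (Ordinal lt_in)) //= !hornerE ti1 subrr.
by rewrite /= mulr0 mul0r eq_sym oppr_eq0 oner_eq0.
Qed.

(* Comparing f (t k) with t^n f k eliminates the top coefficient; t is chosen
   off the roots of unity so that the other coefficients survive. *)
Lemma coef_eq0 n c : (forall k : F, k != 0 -> \sum_(i < n) k ^+ i *: c i = 0) ->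
  forall i, (i < n)%N -> c i = 0.
Proof.
elim: n c => [|n IHn] c c0 i; first by [].
have [t t0 tn1] := non_unity_root_exists n.+1.
have cn0 j : (j < n)%N -> c j = 0.
  move=> lt_jn; pose d i := (t ^+ i - t ^+ n) *: c i.
  have /(_ _ lt_jn): forall i, (i < n)%N -> d i = 0.
    apply: IHn => k k0.
    have := c0 (t * k); rewrite mulf_neq0 // => /(_ isT).
    rewrite big_ord_recr /= => /eqP; rewrite addr_eq0 => /eqP tk.
    have := c0 k k0; rewrite big_ord_recr /= => /eqP.
    rewrite addr_eq0 => /eqP k1.
    transitivity (\sum_(i < n) (t * k) ^+ i *: c i
                  - t ^+ n *: \sum_(i < n) k ^+ i *: c i).
      rewrite scaler_sumr -sumrB; apply: eq_bigr => l _.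
      by rewrite /d !scalerA -scalerBl exprMn; congr (_ *: _); ring.
    by rewrite tk k1 exprMn scalerN scalerA opprK addNr.
  move/eqP; rewrite /d scaler_eq0 => /orP[|/eqP//].
  rewrite -{1}(subnK (ltnW lt_jn)) exprD -{1}[t ^+ j]mul1r -mulrBl.
  rewrite mulf_eq0 expf_eq0 (negPf t0) andbF orbF subr_eq0 eq_sym => tnj.
  have /negP[//] : t ^+ (n - j) != 1.
  by apply: tn1; rewrite subn_gt0 lt_jn ltnS leq_subr.
rewrite ltnS leq_eqVlt => /orP[/eqP->|]; last exact: cn0.
have := c0 1 (oner_neq0 _); rewrite big_ord_recr /= expr1n scale1r.
by rewrite big1 ?add0r // => j _; rewrite cn0 // scaler0.
Qed.

Lemma coef_unique n c d :
    (forall k : F, k != 0 ->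
      \sum_(i < n) k ^+ i *: c i = \sum_(i < n) k ^+ i *: d i) ->
  forall i, (i < n)%N -> c i = d i.
Proof.
move=> cd i lt_in; apply/eqP; rewrite -subr_eq0; apply/eqP.
apply: (@coef_eq0 n (fun i => c i - d i)) => // k k0.
under eq_bigr do rewrite scalerBr.
by rewrite sumrB cd ?subrr.
Qed.

(** Inverting k reverses the list of coefficients. For a map q homogeneous of degree n, applied to q
    (k x + y) and q (k y + x), this reads off the top coefficient q x. *)
Lemma coef_top n c d f g :
    (forall k, f k = \sum_(i < n.+1) k ^+ i *: c i) ->
    (forall k, g k = \sum_(i < n.+1) k ^+ i *: d i) ->
    (forall k, k != 0 -> f k = k ^+ n *: g k^-1) ->
  c n = g 0.
Proof.
move=> fc gd fg.
have -> : g 0 = d 0.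
  rewrite gd big_ord_recl expr0 scale1r big1 ?addr0 // => i _.
  by rewrite expr0n scale0r.
have := @coef_unique n.+1 c (fun i => d (n - i)%N) _ n.
rewrite subnn; apply=> // k k0; rewrite -fc fg // gd scaler_sumr.
rewrite (reindex_inj rev_ord_inj) /=; apply: eq_bigr => i _.
rewrite subSS scalerA exprVn; congr (_ *: _).
have le_in : (i <= n)%N by rewrite -ltnS.
by rewrite -{1}(subnK le_in) exprD mulrAC mulfV ?mul1r // expf_neq0.
Qed.

(** The derivative is formal: both functions share one list of coefficients. At i = 0 the term of
    [g] is zero, so the truncated exponent [i.-1] is harmless. *)
Definition pder n f g := exists c,
  (forall k, f k = \sum_(i < n) k ^+ i *: c i) /\
  (forall k, g k = \sum_(i < n) k ^+ i.-1 *: (c i *+ i)).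

Lemma eq_pder n f f' g g' : f =1 f' -> g =1 g' -> pder n f g -> pder n f' g'.
Proof. by move=> ff gg [c [cf cg]]; exists c; split=> k; rewrite -?ff -?gg. Qed.

Lemma pderD n f f' g g' : pder n f g -> pder n f' g' ->
  pder n (fun k => f k + f' k) (fun k => g k + g' k).
Proof.
move=> [c [cf cg]] [d [df dg]]; exists (fun i => c i + d i).
split=> k; rewrite ?cf ?df ?cg ?dg -big_split /=; apply: eq_bigr => i _.
  by rewrite scalerDr.
by rewrite mulrnDl scalerDr.
Qed.

Lemma pder_cst n x : pder n.+1 (fun=> x) (fun=> 0).
Proof.
exists (fun i => if i is 0%N then x else 0).
split=> k; rewrite big_ord_recl /= ?expr0 ?scale1r ?mulr0n big1 ?addr0 //.
- by move=> i _; rewrite scaler0.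
- by move=> i _; rewrite mul0rn scaler0.
Qed.

Lemma pderW n m f g : (n <= m)%N -> pder n f g -> pder m f g.
Proof.
move=> le_nm [c [cf cg]]; exists (fun i => if (i < n)%N then c i else 0).
split=> k; rewrite ?cf ?cg.
  rewrite (big_ord_widen _ (fun i => k ^+ i *: c i) le_nm) big_mkcond.
  by apply: eq_bigr => i _; case: ifP => // _; rewrite scaler0.
rewrite (big_ord_widen _ (fun i => k ^+ i.-1 *: (c i *+ i)) le_nm) big_mkcond.
by apply: eq_bigr => i _; case: ifP => // _; rewrite mul0rn scaler0.
Qed.

Lemma pder_sum (I : Type) (r : seq I) n (f g : I -> F -> M) :
    (forall i, pder n (f i) (g i)) ->
  pder n (fun k => \sum_(i <- r) f i k) (fun k => \sum_(i <- r) g i k).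
Proof.
move=> fg; elim: r => [|i r IHr].
  apply: (@pderW 0) => //.
  by exists (fun=> 0); split=> k; rewrite big_nil big_ord0.
by apply: eq_pder (pderD (fg i) IHr) => k; rewrite big_cons.
Qed.

Lemma pderX n f g : pder n f g ->
  pder n.+1 (fun k => k *: f k) (fun k => f k + k *: g k).
Proof.
move=> [c [cf cg]]; exists (fun i => if i is j.+1 then c j else 0).
split=> k; rewrite big_ord_recl /= ?mulr0n scaler0 add0r ?cf ?cg scaler_sumr.
  by apply: eq_bigr => i _; rewrite scalerA -exprS.
rewrite -big_split /=; apply: eq_bigr => i _ /=.
rewrite /bump add1n /= scalerA -exprS mulrS scalerDr; congr (_ + _).
by case: (nat_of_ord i) => [|j] /=; rewrite ?mulr0n ?scaler0.
Qed.

Lemma pder_additive n f g (phi : M -> M) :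
    (forall (a : F) x y, phi (a *: x + y) = a *: phi x + phi y) ->
  pder n f g -> pder n (phi \o f) (phi \o g).
Proof.
move=> phi_lin [c [cf cg]]; exists (phi \o c).
have phi0 : phi 0 = 0.
  by have := phi_lin (-1) 0 0; rewrite scaler0 addr0 scaleN1r addNr.
have phiD x y : phi (x + y) = phi x + phi y.
  by have := phi_lin 1 x y; rewrite !scale1r.
have phiZ a x : phi (a *: x) = a *: phi x.
  by have := phi_lin a x 0; rewrite phi0 !addr0.
have phiMn x i : phi (x *+ i) = phi x *+ i.
  by rewrite -[x *+ i]scaler_nat phiZ scaler_nat.
by split=> k; rewrite /= ?cf ?cg (big_morph phi phiD phi0); apply: eq_bigr => i _;
  rewrite phiZ ?phiMn.
Qed.

Lemma pder_affine x y : pder 2 (fun k => k *: x + y) (fun=> x).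
Proof.
apply: eq_pder (pderD (pderX (pder_cst 0 x)) (pder_cst 1 y)) => // k.
by rewrite scaler0 !addr0.
Qed.

End PolynomialFunctions.

(** * Iterated adjoint maps, and the bracket over the dual numbers *)

Section BilinearMaps.
Variables (F : fieldType) (M : lmodType F) (br : M -> M -> M).
Hypothesis br_bilin : bilin_map br.

Lemma brDl x y z : br (x + y) z = br x z + br y z.
Proof. by have := br_bilin.1 1 x y z; rewrite !scale1r. Qed.

Lemma brDr x y z : br z (x + y) = br z x + br z y.
Proof. by have := br_bilin.2 1 x y z; rewrite !scale1r. Qed.

Lemma br0l z : br 0 z = 0.
Proof. by apply: (addrI (br 0 z)); rewrite -brDl !addr0. Qed.

Lemma br0r z : br z 0 = 0.
Proof. by apply: (addrI (br z 0)); rewrite -brDr !addr0. Qed.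

Lemma brZl a x z : br (a *: x) z = a *: br x z.
Proof. by have := br_bilin.1 a x 0 z; rewrite br0l !addr0. Qed.

Lemma brZr a x z : br z (a *: x) = a *: br z x.
Proof. by have := br_bilin.2 a x 0 z; rewrite br0r !addr0. Qed.

Lemma brNl x z : br (- x) z = - br x z.
Proof. by rewrite -!scaleN1r brZl. Qed.

Lemma brNr x z : br z (- x) = - br z x.
Proof. by rewrite -!scaleN1r brZr. Qed.

Lemma brMnr x z n : br z (x *+ n) = br z x *+ n.
Proof. by rewrite -!scaler_nat brZr. Qed.

Lemma br_sumr (I : Type) (r : seq I) (f : I -> M) z :
  br z (\sum_(i <- r) f i) = \sum_(i <- r) br z (f i).
Proof. exact: (big_morph _ (fun x y => brDr x y z) (br0r z)). Qed.

Lemma br_suml (I : Type) (r : seq I) (f : I -> M) z :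
  br (\sum_(i <- r) f i) z = \sum_(i <- r) br (f i) z.
Proof. exact: (big_morph (br^~ z) (fun x y => brDl x y z) (br0l z)). Qed.

Lemma iter_brZ n a x y : iter n (br x) (a *: y) = a *: iter n (br x) y.
Proof. by elim: n => //= n ->; rewrite brZr. Qed.

Lemma iter_brZl n a x y : iter n (br (a *: x)) y = a ^+ n *: iter n (br x) y.
Proof.
by elim: n => [|n IHn] /=; rewrite ?scale1r // IHn brZl brZr scalerA -exprS.
Qed.

(* [ad_coef E U H n j] is the coefficient of [c ^+ j] in ad(cE + U)^n H. *)
Fixpoint ad_coef (E U H : M) n j : M :=
  match n, j with
  | 0, 0 => H
  | 0, _.+1 => 0
  | n'.+1, 0 => br U (ad_coef E U H n' 0)
  | n'.+1, j'.+1 => br E (ad_coef E U H n' j') + br U (ad_coef E U H n' j'.+1)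
  end.

Lemma ad_coef_gt E U H n j : (n < j)%N -> ad_coef E U H n j = 0.
Proof.
elim: n j => [|n IHn] [|j] //= lt_nj.
by rewrite !IHn ?br0r ?addr0 // ltnW.
Qed.

Lemma ad_coef_sum E U H n c :
  iter n (br (c *: E + U)) H = \sum_(j < n.+1) c ^+ j *: ad_coef E U H n j.
Proof.
elim: n => [|n IHn] /=; first by rewrite big_ord1 scale1r.
rewrite IHn brDl [RHS]big_ord_recl /=.
under [in RHS]eq_bigr do rewrite /bump add1n scalerDr.
rewrite big_split /= [RHS]addrCA; congr (_ + _).
  rewrite brZl br_sumr scaler_sumr; apply: eq_bigr => i _.
  by rewrite brZr scalerA -exprS.
rewrite expr0 scale1r br_sumr big_ord_recl brZr scale1r; congr (_ + _).
rewrite big_ord_recr /= ad_coef_gt // br0r scaler0 addr0.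
by apply: eq_bigr => i _; rewrite brZr.
Qed.

Lemma ad_coefZ a E U H n j :
  ad_coef (a *: E) (a *: U) (a *: H) n j = a ^+ n.+1 *: ad_coef E U H n j.
Proof.
elim: n j => [|n IHn] [|j] /=; rewrite ?expr1 ?scaler0 //.
  by rewrite IHn brZl brZr scalerA -exprS.
by rewrite !IHn !brZl !brZr !scalerA -exprS scalerDr.
Qed.

Lemma ad_coef0 E U n j : ad_coef E U 0 n j = 0.
Proof. by elim: n j => [|n IHn] [|j] //=; rewrite ?IHn !br0r ?addr0. Qed.

Lemma ad_coefU0 E n j : br E E = 0 -> ad_coef E 0 E n.+1 j = 0.
Proof.
move=> EE; elim: n j => [|n IHn] j.
  by case: j => [|[|j]] /=; rewrite ?br0l ?br0r ?EE ?addr0.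
case: j => [|j]; first exact: br0l.
rewrite -[LHS]/(br E (ad_coef E 0 E n.+1 j) + br 0 (ad_coef E 0 E n.+1 j.+1)).
by rewrite !IHn !br0r addr0.
Qed.

(* The bracket of M over the dual numbers: (x, h) stands for x + eps h. *)
Definition dual_br (x y : M * M) : M * M :=
  (br x.1 y.1, br x.1 y.2 + br x.2 y.1).

Lemma dual_br_bilin : bilin_map dual_br.
Proof.
split=> a [x x'] [y y'] [z z'].
  apply: (congr2 pair); first exact: br_bilin.1.
  by rewrite /= !br_bilin.1 scalerDr addrACA.
apply: (congr2 pair); first exact: br_bilin.2.
by rewrite /= !br_bilin.2 scalerDr addrACA.
Qed.

Lemma iter_dual_br1 n x y : (iter n (dual_br x) y).1 = iter n (br x.1) y.1.
Proof. by elim: n => //= n ->. Qed.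

(** Leibniz rule: either the operator ad(x)^n is differentiated along h, or its argument is. *)
Lemma iter_dual_br2 n x h y z :
  (iter n (dual_br (x, h)) (y, z)).2
  = (iter n (dual_br (x, h)) (y, 0)).2 + iter n (br x) z.
Proof.
elim: n => [|n IHn] /=; first by rewrite add0r.
by rewrite IHn !iter_dual_br1 brDr addrAC.
Qed.

End BilinearMaps.

Lemma ad_coef_dual1 (F : fieldType) (M : lmodType F) (br : M -> M -> M) E U H n j :
  (ad_coef (dual_br br) E U H n j).1 = ad_coef br E.1 U.1 H.1 n j.
Proof. by elim: n j => [|n IHn] [|j] //=; rewrite ?IHn. Qed.

(** * Derivatives in k of iterated brackets *)

Section BilinearDerivatives.
Variables (F : closedFieldType) (M : lmodType F) (br : M -> M -> M).
Hypothesis br_bilin : bilin_map br.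

Lemma pder_br n x y (f g : F -> M) : pder n f g ->
  pder n.+1 (fun k => br (k *: x + y) (f k))
            (fun k => br (k *: x + y) (g k) + br x (f k)).
Proof.
move=> fg.
have fgx := pderX (pder_additive (fun a u v => br_bilin.2 a u v x) fg).
have fgy := pder_additive (fun a u v => br_bilin.2 a u v y) fg.
apply: eq_pder (pderD fgx (pderW (leqnSn n) fgy)) => k /=.
  by rewrite (brDl br_bilin) (brZl br_bilin).
by rewrite (brDl br_bilin) (brZl br_bilin) -addrA addrC.
Qed.

(** The pencil k x + y has derivative x, so iterating over the dual numbers carries the value and
    its derivative along together. Each bracket raises the degree bound by one. *)
Lemma pder_ad n m x y (f g : F -> M) : pder m f g ->
  pder (n + m) (fun k => iter n (br (k *: x + y)) (f k))
     (fun k => (iter n (dual_br br (k *: x + y, x)) (f k, g k)).2).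
Proof.
move=> fg; elim: n => [|n IHn] //=.
by apply: eq_pder (pder_br x y IHn) => k //=; rewrite iter_dual_br1.
Qed.

Lemma pder_ad_coef n j E' E U' U H' H :
  pder n.+2 (fun k => ad_coef br (k *: E' + E) (k *: U' + U) (k *: H' + H) n j)
    (fun k => (ad_coef (dual_br br)
         (k *: E' + E, E') (k *: U' + U, U') (k *: H' + H, H') n j).2).
Proof.
elim: n j => [|n IHn] [|j] /=.
- exact: pder_affine.
- exact: pder_cst.
- by apply: eq_pder (pder_br _ _ (IHn _)) => // k; rewrite ad_coef_dual1.
- apply: eq_pder (pderD (pder_br _ _ (IHn _)) (pder_br _ _ (IHn _))) => // k.
  by rewrite !ad_coef_dual1.
Qed.

End BilinearDerivatives.

(** * Lie p-structures and binomial identities in characteristic p *)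

Definition lie_bracket (F : fieldType) (M : lmodType F) (br : M -> M -> M) :=
  [/\ bilin_map br, (forall x y, br x y = - br y x)
    & (forall x y z, br x (br y z) = br (br x y) z + br y (br x z))].

Definition lie_p_structure (F : fieldType) (M : lmodType F) (br : M -> M -> M)
    (p : nat) (pm : M -> M) :=
  [/\ (forall x y, br (pm x) y = iter p (br x) y),
      (forall (k : F) x, pm (k *: x) = k ^+ p *: pm x)
    & (forall x y, exists s : nat -> M,
          (forall k : F, iter p.-1 (br (k *: x + y)) x
                         = \sum_(1 <= i < p) k ^+ i.-1 *: (s i *+ i))
          /\ pm (x + y) = pm x + pm y + \sum_(1 <= i < p) s i)].

Section LieIdentities.
Variables (F : fieldType) (M : lmodType F) (br : M -> M -> M) (p : nat).
Hypotheses (lie : lie_bracket br) (chF : p \in [pchar F]) (p_gt2 : (2 < p)%N).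

Let br_bilin : bilin_map br. Proof. by case: lie. Qed.

Lemma lie_brxx x : br x x = 0.
Proof.
have [_ skew _] := lie; have /eqP := skew x x.
rewrite -addr_eq0 -mulr2n -scaler_nat scaler_eq0 => /orP[|/eqP//].
rewrite -(dvdn_pcharf chF) => /dvdn_leq => /(_ isT).
by rewrite leqNgt p_gt2.
Qed.

(** The derivative of ad(x)^n along h is a sum of words with one factor ad(h). The Jacobi identity
    moves that factor to the left, and Pascal's rule closes the induction. *)
Lemma dual_ad_binomial n x h y :
  (iter n (dual_br br (x, h)) (y, 0)).2
  = \sum_(j < n) br (iter j (br x) h) (iter (n.-1 - j) (br x) y) *+ 'C(n, j.+1).
Proof.
have [_ _ jac] := lie.
elim: n => [|n IHn]; first by rewrite big_ord0.
rewrite /= iter_dual_br1 IHn (br_sumr br_bilin) /=.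
rewrite (eq_bigr (fun j : 'I_n =>
    br (iter j.+1 (br x) h) (iter (n - j.+1) (br x) y) *+ 'C(n, j.+1)
    + br (iter j (br x) h) (iter (n - j) (br x) y) *+ 'C(n, j.+1))); last first.
  move=> j _; rewrite (brMnr br_bilin) jac mulrnDl; have lt_jn := ltn_ord j.
  have -> : (n - j = (n.-1 - j).+1)%N by lia.
  by have -> : (n - j.+1 = n.-1 - j)%N by lia.
rewrite /= big_split /=.
under [RHS]eq_bigr do rewrite binS mulrnDr.
rewrite big_split /= -addrA addrCA; congr (_ + _).
  by rewrite [RHS]big_ord_recr /= bin_small // mulr0n addr0.
rewrite [RHS]big_ord_recl /= subn0 bin0 mulr1n addrC; congr (_ + _).
Qed.

Let p_pr : prime p. Proof. exact: pcharf_prime chF. Qed.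

(** All binomials C(p, j+1) with j < p - 1 vanish in F; only the last term survives. *)
Lemma dual_ad_p x h y :
  (iter p (dual_br br (x, h)) (y, 0)).2 = br (iter p.-1 (br x) h) y.
Proof.
rewrite dual_ad_binomial -(prednK (prime_gt0 p_pr)) big_ord_recr /= subnn.
rewrite prednK ?prime_gt0 // binn big1 ?add0r // => i _.
rewrite -scaler_nat; have /eqP -> : ('C(p, i.+1)%:R : F) == 0.
  rewrite -(dvdn_pcharf chF) prime_dvd_bin //=.
  by have := ltn_ord i; have := prime_gt0 p_pr; lia.
by rewrite scale0r.
Qed.

(** Pascal's rule in row p, whose inner entries are zero in F, makes the signs alternate. *)
Lemma bin_p1 j : (j < p)%N -> 'C(p.-1, j)%:R = (-1) ^+ j :> F.
Proof.
elim: j => [|j IHj] lt_jp; first by rewrite bin0.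
have : ('C(p, j.+1)%:R : F) = 0.
  by apply/eqP; rewrite -(dvdn_pcharf chF) prime_dvd_bin.
rewrite -{1}(prednK (prime_gt0 p_pr)) binS natrD IHj 1?ltnW // => /eqP.
by rewrite addr_eq0 => /eqP->; rewrite exprS mulN1r.
Qed.

(* The 1-form h |-> ad(x)^(p-1) h on M is closed. *)
Lemma dual_ad_closed x h y :
  (iter p.-1 (dual_br br (x, h)) (y, 0)).2
  = (iter p.-1 (dual_br br (x, y)) (h, 0)).2.
Proof.
have [_ skew _] := lie.
(* Reversing j exchanges the two arguments of the bracket. As p is odd, j and p - 2 - j have
   opposite parity, so the binomial signs cancel the sign of skew symmetry. *)
rewrite !dual_ad_binomial (reindex_inj rev_ord_inj) /=; apply: eq_bigr => j _.
have lt_jp := ltn_ord j.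
rewrite skew -!scaler_nat !bin_p1; try lia.
have -> : (p.-1.-1 - (p.-1 - j.+1) = j)%N by lia.
have -> : (p.-1.-1 - j = p.-1 - j.+1)%N by lia.
rewrite scalerN -scaleNr; congr (_ *: _).
rewrite -signr_odd -[in RHS]signr_odd.
have podd : odd p by case: (even_prime p_pr) p_gt2 => [->|].
have -> : odd (p.-1 - j.+1).+1 = ~~ odd j.+1.
  by move: lt_jp podd; lia.
by case: (odd j.+1); rewrite ?expr0 ?expr1 ?opprK.
Qed.

End LieIdentities.

(** Shifting the derivative to exponents starting at 0 leaves room for one extra coefficient, filled
    with [c n = 0]. *)
Lemma pder_shift (F : closedFieldType) (M : lmodType F) n (f g : F -> M) :
    pder n f g ->
  exists c : nat -> M, [/\ c n = 0, forall k, f k = \sum_(i < n) k ^+ i *: c i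
    & forall k, g k = \sum_(i < n) k ^+ i *: (c i.+1 *+ i.+1)].
Proof.
move=> [c [cf cg]]; exists (fun i => if (i < n)%N then c i else 0).
split=> [|k|k]; first by rewrite ltnn.
  by rewrite cf; apply: eq_bigr => i _; rewrite ltn_ord.
rewrite cg; case: n {cf cg} => [|n]; first by rewrite !big_ord0.
rewrite big_ord_recl mulr0n scaler0 add0r big_ord_recr /= ltnn mul0rn scaler0.
by rewrite addr0; apply: eq_bigr => i _; rewrite /bump add1n !ltnS ltn_ord.
Qed.

Section SumEnds.
Variables (M : zmodType) (p : nat) (G : nat -> M).
Hypothesis p_gt0 : (0 < p)%N.

Lemma sum_head : \sum_(i < p) G i = G 0 + \sum_(i < p.-1) G i.+1.
Proof. by case: p p_gt0 => // q _; rewrite big_ord_recl. Qed.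

Lemma sum_last : \sum_(i < p) G i = \sum_(i < p.-1) G i + G p.-1.
Proof. by case: p p_gt0 => // q _; rewrite big_ord_recr. Qed.

Lemma sum_ends : \sum_(i < p.+1) G i = G 0 + \sum_(i < p.-1) G i.+1 + G p.
Proof. by rewrite big_ord_recr sum_head. Qed.

Lemma sum_from1 : \sum_(1 <= i < p) G i = \sum_(i < p.-1) G i.+1.
Proof. by case: p p_gt0 => // q _; rewrite big_add1 big_mkord. Qed.

End SumEnds.

(** * Jacobson's formula and the extension of a p-map from a hyperplane *)

Section Jacobson.
Variables (F : closedFieldType) (M : lmodType F) (br : M -> M -> M) (p : nat).
Hypotheses (lie : lie_bracket br) (chF : p \in [pchar F]) (p_gt2 : (2 < p)%N).

Let br_bilin : bilin_map br. Proof. by case: lie. Qed.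
Let p_gt0 : (0 < p)%N. Proof. by case: p p_gt2. Qed.

Lemma natr_unit i : (i < p.-1)%N -> i.+1%:R != 0 :> F.
Proof. by move=> lt_ip; rewrite -(dvdn_pcharf chF) gtnNdvd //; lia. Qed.

Lemma mulrn_inj (x y : M) i : (i < p.-1)%N -> x *+ i.+1 = y *+ i.+1 -> x = y.
Proof.
move=> lt_ip; rewrite -!scaler_nat => /scalerI; apply; exact: natr_unit.
Qed.

Lemma mulrn_eq (x y : M) i : (i < p.-1)%N -> x *+ i.+1 = y ->
  x = i.+1%:R^-1 *: y.
Proof.
move=> lt_ip <-; rewrite -scaler_nat scalerA mulVf ?scale1r //.
exact: natr_unit.
Qed.

Lemma mulrnp (x : M) : x *+ p = 0.
Proof. by rewrite -scaler_nat (pcharf0 chF) scale0r. Qed.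

(* The sum of the Lie polynomials s_1(x,y), ..., s_(p-1)(x,y) of (R3). *)
Definition jacobson x y : M :=
  \sum_(i < p.-1) i.+1%:R^-1 *: ad_coef br x y x p.-1 i.

Lemma jacobsonZ a x y : jacobson (a *: x) (a *: y) = a ^+ p *: jacobson x y.
Proof.
rewrite /jacobson scaler_sumr; apply: eq_bigr => i _.
by rewrite (ad_coefZ br_bilin) prednK // !scalerA mulrC.
Qed.

Lemma jacobson0l y : jacobson 0 y = 0.
Proof. by rewrite /jacobson big1 // => i _; rewrite ad_coef0 // scaler0. Qed.

Lemma jacobson0r x : jacobson x 0 = 0.
Proof.
rewrite /jacobson big1 // => -[i _] _ /=.
have -> : p.-1 = p.-2.+1 by lia.
by rewrite (ad_coefU0 br_bilin) ?scaler0 //; exact: (lie_brxx lie chF).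
Qed.

(** By [dual_ad_p], the derivative of ad(k x + y)^p z is the bracket of ad(k x + y)^(p-1) x with z.
    Dividing its coefficients by 1, ..., p - 1 gives the middle coefficients; the extreme ones are
    the two p-th powers. *)
Lemma bracket_jacobson x y z :
  iter p (br (x + y)) z
  = iter p (br x) z + iter p (br y) z + br (jacobson x y) z.
Proof.
have pder_p u v : pder p.+1 (fun k => iter p (br (k *: u + v)) z)
    (fun k => br (iter p.-1 (br (k *: u + v)) u) z).
  rewrite -addn1; apply: eq_pder (pder_ad br_bilin _ u v (pder_cst 0 z)) => // k.
  exact: dual_ad_p.
have [c [cp cf cg]] := pder_shift (pder_p x y).
have [d [_ df _]] := pder_shift (pder_p y x).
have ci i : (i < p)%N -> c i.+1 *+ i.+1 = br (ad_coef br x y x p.-1 i) z.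
  move=> lt_ip; apply: (@coef_unique _ _ p (fun i => c i.+1 *+ i.+1)
    (fun i => br (ad_coef br x y x p.-1 i) z)) lt_ip.
  move=> k _; have := cg k.
  rewrite big_ord_recr /= cp mul0rn scaler0 addr0 => <-.
  rewrite (ad_coef_sum br_bilin) prednK // (br_suml br_bilin).
  by apply: eq_bigr => j _; rewrite (brZl br_bilin).
have cpE : c p = iter p (br x) z.
  rewrite -[x in RHS]add0r -[in RHS](scale0r y).
  apply: (coef_top cf df) => k k0.
  rewrite -(iter_brZl br_bilin) scalerDr scalerA mulfV // scale1r.
  by rewrite addrC.
have c0E : c 0%N = iter p (br y) z.
  have := cf 0; rewrite scale0r add0r => ->.
  rewrite big_ord_recl expr0 scale1r big1 ?addr0 // => i _.
  by rewrite expr0n scale0r.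
have := cf 1; rewrite scale1r => ->.
rewrite (sum_ends (fun i => 1 ^+ i *: c i)) // !expr1n !scale1r c0E cpE.
rewrite addrC addrA; congr (_ + _).
rewrite /jacobson (br_suml br_bilin); apply: eq_bigr => i _.
rewrite expr1n scale1r (brZl br_bilin); apply: mulrn_eq => //.
by apply: ci; have := ltn_ord i; lia.
Qed.

(* By closedness, the derivative of ad(cE + U)^(p-1) E in the direction of
   cE' + U' is the c-derivative of ad(cE + U)^(p-1) (cE' + U'). *)
Lemma jacobson_direction E E' U U' : br E E' = 0 ->
  \sum_(i < p.-1) i.+1%:R^-1 *:
    (ad_coef (dual_br br) (E, E') (U, U') (E, E') p.-1 i).2
  = iter p.-1 (br (E + U)) (E' + U') - iter p.-1 (br U) U'.
Proof.
have [_ skew _] := lie.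
move=> EE'.
pose v1 := br E U' + br U E'; pose v0 := br U U'.
pose X c := c *: E + U; pose h c := c *: E' + U'.
(* As E and E' commute, this is affine in c rather than quadratic. Hence ad(X c)^(p-1) (h c) has
   degree below p, and no c^p term escapes differentiation. *)
have Xh c : br (X c) (h c) = c *: v1 + v0.
  rewrite /X /h (brDl br_bilin) !(brDr br_bilin) !(brZl br_bilin) !(brZr br_bilin).
  by rewrite EE' !scaler0 add0r addrA -scalerDr.
have p12 : p.-1 = p.-2.+1 by lia.
have psi : pder p (fun c => iter p.-1 (br (X c)) (h c))
    (fun c => (iter p.-1 (dual_br br (X c, h c)) (E, E')).2).
  have {1}-> : p = (p.-2 + 2)%N by lia.
  apply: eq_pder (pder_ad br_bilin _ E U (pder_affine v1 v0)) => c.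
    by rewrite p12 iterSr Xh.
  have -> : (c *: v1 + v0, v1) = dual_br br (X c, E) (h c, E').
    apply: (congr2 pair); rewrite /= ?Xh // /X /h (brDl br_bilin) (brDr br_bilin).
    by rewrite (brZl br_bilin) (brZr br_bilin) EE' !scaler0 !add0r addrC.
  (* Closedness exchanges the direction E with the argument [h c]. *)
  rewrite -iterSr -p12 iter_dual_br2 // (dual_ad_closed lie chF) //.
  by rewrite -iter_dual_br2.
have [c [cp cf cg]] := pder_shift psi.
have ci i : (i < p)%N -> c i.+1 *+ i.+1
    = (ad_coef (dual_br br) (E, E') (U, U') (E, E') p.-1 i).2.
  move=> lt_ip; apply: (@coef_unique _ _ p (fun i => c i.+1 *+ i.+1)
    (fun i => (ad_coef (dual_br br) (E, E') (U, U') (E, E') p.-1 i).2)) lt_ip.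
  move=> k _; rewrite -cg.
  have -> : (X k, h k) = k *: (E, E') + (U, U') by [].
  rewrite (ad_coef_sum (dual_br_bilin br_bilin)) prednK //.
  by rewrite (big_morph snd (id1 := 0) (op1 := +%R)).
(* The values at c = 1 and c = 0 differ by the integrated coefficients of the derivative. *)
have := cf 1; rewrite /X /h !scale1r => ->.
have := cf 0; rewrite /X /h !scale0r !add0r => ->.
rewrite !(sum_head (fun i => _ ^+ i *: c i)) // [X in _ + _ - (_ + X)]big1.
  rewrite !expr0 addr0 addrC addKr; apply: eq_bigr => i _.
  rewrite expr1n scale1r; apply/esym/mulrn_eq => //.
  by apply: ci; have := ltn_ord i; lia.
by move=> i _; rewrite exprS mul0r scale0r.
Qed.

(** The first term is the derivative wanted for the whole pencil; the subtracted one will cancel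
    against the derivative of the p-map on the hyperplane. *)
Lemma pder_jacobson E' E U' U : br E E' = 0 ->
  pder p.+1 (fun k => jacobson (k *: E' + E) (k *: U' + U))
    (fun k => iter p.-1 (br (k *: E' + E + (k *: U' + U))) (E' + U')
              - iter p.-1 (br (k *: U' + U)) U').
Proof.
move=> EE'.
pose f i k := i.+1%:R^-1 *:
  ad_coef br (k *: E' + E) (k *: U' + U) (k *: E' + E) p.-1 i.
pose g i k := i.+1%:R^-1 *: (ad_coef (dual_br br)
  (k *: E' + E, E') (k *: U' + U, U') (k *: E' + E, E') p.-1 i).2.
have fg (i : 'I_p.-1) : pder p.+1 (f i) (g i).
  have {1}-> : p = p.-1.+1 by lia.
  apply: pder_additive (pder_ad_coef br_bilin _ _ _ _ _ _ _ _) => a x y.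
  by rewrite scalerDr !scalerA mulrC.
apply: eq_pder (pder_sum _ fg) => // k.
apply: jacobson_direction.
rewrite (brDl br_bilin) (brZl br_bilin) EE' addr0.
by rewrite (lie_brxx lie chF) // scaler0.
Qed.

(** The s_i are the middle coefficients of k |-> pm (k x + y), and k = 1 gives the sum formula.
    Homogeneity identifies the end coefficients; that of k^p has derivative zero. *)
Lemma additivity_of_pder (pm : M -> M) x y :
    (forall (k : F) z, pm (k *: z) = k ^+ p *: pm z) ->
    (forall x y, pder p.+1 (fun k => pm (k *: x + y))
                           (fun k => iter p.-1 (br (k *: x + y)) x)) ->
  exists s : nat -> M,
    (forall k : F, iter p.-1 (br (k *: x + y)) x
                   = \sum_(1 <= i < p) k ^+ i.-1 *: (s i *+ i))
    /\ pm (x + y) = pm x + pm y + \sum_(1 <= i < p) s i.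
Proof.
move=> pmZ pm_der.
have [c [cp cf cg]] := pder_shift (pm_der x y).
have [d [_ df _]] := pder_shift (pm_der y x).
exists c; split=> [k|].
  rewrite cg big_ord_recr /= cp mul0rn scaler0 addr0.
  rewrite (sum_last (fun i => _ ^+ i *: (c i.+1 *+ i.+1))) //.
  by rewrite prednK // mulrnp scaler0 addr0 (sum_from1 (fun i => _ *: _)).
have cpE : c p = pm x.
  rewrite -[x in RHS]add0r -[in RHS](scale0r y).
  apply: (coef_top cf df) => k k0.
  by rewrite -pmZ scalerDr scalerA mulfV // scale1r addrC.
have c0E : c 0%N = pm y.
  have := cf 0; rewrite scale0r add0r => ->.
  rewrite big_ord_recl expr0 scale1r big1 ?addr0 // => i _.
  by rewrite expr0n scale0r.
have := cf 1; rewrite scale1r => ->.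
rewrite (sum_ends (fun i => 1 ^+ i *: c i)) // !expr1n !scale1r c0E cpE.
rewrite addrC addrA; congr (_ + _); rewrite sum_from1 //.
by apply: eq_bigr => i _; rewrite expr1n scale1r.
Qed.

(** A converse on a subset stable under scaling, later the hyperplane: (R3) at the pair (k x, y)
    exhibits q (k x + y) as a polynomial in k. *)
Lemma pder_of_additivity (N : M -> Prop) (q : M -> M) :
    (forall (k : F) x, N x -> N (k *: x)) ->
    (forall (k : F) x, N x -> q (k *: x) = k ^+ p *: q x) ->
    (forall x y, N x -> N y -> exists s : nat -> M,
       (forall k : F, iter p.-1 (br (k *: x + y)) x
                      = \sum_(1 <= i < p) k ^+ i.-1 *: (s i *+ i))
       /\ q (x + y) = q x + q y + \sum_(1 <= i < p) s i) ->
  forall x y, N x -> N y -> pder p.+1 (fun k => q (k *: x + y))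
                           (fun k => iter p.-1 (br (k *: x + y)) x).
Proof.
move=> NZ qZ qD x y Nx Ny; have [s [sE _]] := qD x y Nx Ny.
pose c i := if i == 0%N then q y else if i == p then q x else s i.
have sum_if (G : nat -> M -> M) : \sum_(i < p.-1) G i (c i.+1)
   = \sum_(i < p.-1) G i (s i.+1).
  apply: eq_bigr => i _; rewrite /c /=; case: eqP => // ip.
  by have := ltn_ord i; lia.
have c0 : c 0%N = q y by [].
have cp : c p = q x by rewrite /c (negPf (lt0n_neq0 p_gt0)) eqxx.
exists c; split=> k.
  rewrite (sum_ends (fun i => k ^+ i *: c i)) // c0 cp.
  rewrite (sum_if (fun i z => k ^+ i.+1 *: z)) expr0 scale1r.
  (* The elements t for (k x, y) are a priori unrelated to s; comparing coefficients in a second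
     variable j yields t_i = k^i s_i. *)
  have [t [tE ->]] := qD _ _ (NZ k x Nx) Ny; rewrite qZ // sum_from1 //.
  rewrite [RHS]addrC addrA; congr (_ + _); apply: eq_bigr => i _.
  apply: (@mulrn_inj _ _ i) => //.
  apply: (@coef_unique _ _ p.-1 (fun i => t i.+1 *+ i.+1)
     (fun i => k ^+ i.+1 *: s i.+1 *+ i.+1)) => // j _.
  have := tE j; rewrite sum_from1 //= => <-.
  rewrite (iter_brZ br_bilin) scalerA sE sum_from1 // scaler_sumr.
  apply: eq_bigr => l _ /=; rewrite -!scaler_nat !scalerA; congr (_ *: _).
  by rewrite exprMn exprS; ring.
rewrite sE sum_from1 //= (sum_ends (fun i => k ^+ i.-1 *: (c i *+ i))) //.
rewrite /= mulr0n scaler0 add0r mulrnp scaler0 addr0.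
by rewrite (sum_if (fun i z => k ^+ i *: (z *+ i.+1))).
Qed.

(* M = F E + ker a; a p-structure on ker a and a p-th power g of E determine
   the p-structure on M. *)
Variables (a : M -> F) (E g : M) (q : M -> M).
Hypotheses (a_lin : forall (k : F) x y, a (k *: x + y) = k * a x + a y)
  (aE : a E = 1)
  (adE : forall y, br g y = iter p (br E) y)
  (ad_q : forall x, a x = 0 -> forall y, br (q x) y = iter p (br x) y)
  (qZ : forall (k : F) x, a x = 0 -> q (k *: x) = k ^+ p *: q x)
  (qD : forall x y, a x = 0 -> a y = 0 -> exists s : nat -> M,
     (forall k : F, iter p.-1 (br (k *: x + y)) x
                    = \sum_(1 <= i < p) k ^+ i.-1 *: (s i *+ i))
     /\ q (x + y) = q x + q y + \sum_(1 <= i < p) s i).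

Definition p_extension x : M :=
  a x ^+ p *: g + q (x - a x *: E) + jacobson (a x *: E) (x - a x *: E).

Let a0 : a 0 = 0.
Proof. by have := a_lin (-1) 0 0; rewrite scaler0 addr0 mulN1r addNr. Qed.

Let aZ (k : F) x : a (k *: x) = k * a x.
Proof. by have := a_lin k x 0; rewrite a0 !addr0. Qed.

Let a_rest x : a (x - a x *: E) = 0.
Proof. by rewrite addrC -scaleNr a_lin aE mulr1 addNr. Qed.

Lemma p_extension_ker x : a x = 0 -> p_extension x = q x.
Proof.
move=> ax0; rewrite /p_extension ax0 scale0r subr0 jacobson0l addr0.
by rewrite expr0n eqn0Ngt p_gt0 scale0r add0r.
Qed.

Lemma p_extension_gen : p_extension E = g.
Proof.
rewrite /p_extension aE expr1n !scale1r subrr jacobson0r addr0.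
have := qZ 0 a0; rewrite expr0n eqn0Ngt p_gt0 !scale0r => ->.
exact: addr0.
Qed.

Lemma p_extensionZ (k : F) x : p_extension (k *: x) = k ^+ p *: p_extension x.
Proof.
rewrite /p_extension aZ -scalerA -scalerBr jacobsonZ qZ ?a_rest //.
by rewrite !scalerDr exprMn scalerA.
Qed.

(** By Frobenius the term in g has only coefficients of k^0 and k^p, hence derivative zero. The
    derivative of the q-term cancels the subtracted term of [pder_jacobson]. *)
Lemma pder_p_extension x y : pder p.+1 (fun k => p_extension (k *: x + y))
  (fun k => iter p.-1 (br (k *: x + y)) x).
Proof.
pose x' := x - a x *: E; pose y' := y - a y *: E.
have kerZ (k : F) z : a z = 0 -> a (k *: z) = 0 by rewrite aZ => ->; rewrite mulr0.
have dq := pder_of_additivity kerZ qZ qD (a_rest x) (a_rest y).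
have dT : pder p.+1 _ _ := @pder_jacobson (a x *: E) (a y *: E) x' y' _.
have dg : pder p.+1 (fun k => (k * a x + a y) ^+ p *: g) (fun=> 0).
  pose c i := if i == 0%N then a y ^+ p *: g
              else if i == p then a x ^+ p *: g else 0.
  have c0 : c 0%N = a y ^+ p *: g by [].
  have cp : c p = a x ^+ p *: g by rewrite /c (negPf (lt0n_neq0 p_gt0)) eqxx.
  have ci (i : 'I_p.-1) : c i.+1 = 0.
    by rewrite /c /=; case: eqP => // ip; have := ltn_ord i; lia.
  exists c; split=> k.
    rewrite (sum_ends (fun i => k ^+ i *: c i)) // c0 cp.
    rewrite big1 => [|i _]; last by rewrite ci scaler0.
    rewrite addr0 expr0 scale1r scalerA -scalerDl -exprMn.
    rewrite [_ + (k * a x) ^+ p]addrC.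
    by have := pFrobenius_autD_comm chF (mulrC (k * a x) (a y));
      rewrite !pFrobenius_autE => ->.
  rewrite (sum_ends (fun i => k ^+ i.-1 *: (c i *+ i))) //.
  rewrite mulr0n scaler0 add0r mulrnp scaler0 addr0 big1 // => i _.
  by rewrite ci mul0rn scaler0.
have split_kxy k : k *: x + y
    = (k *: (a x *: E) + a y *: E) + (k *: x' + y').
  by rewrite addrACA -scalerDr [a x *: E + _]addrC [a y *: E + _]addrC !subrK.
apply: eq_pder (pderD (pderD dg dq) (dT _)) => [k|k|].
- have ak : a (k *: x + y) = k * a x + a y by rewrite a_lin.
  have Ek : a (k *: x + y) *: E = k *: (a x *: E) + a y *: E.
    by rewrite ak scalerDl scalerA.
  have xk : k *: x + y - a (k *: x + y) *: E = k *: x' + y'.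
    by rewrite Ek {1}split_kxy addrC addKr.
  by rewrite /p_extension xk Ek ak.
- rewrite add0r addrCA subrr addr0 -split_kxy.
  by rewrite [a x *: E + _]addrC subrK.
- by rewrite (brZl br_bilin) (brZr br_bilin) (lie_brxx lie chF) // !scaler0.
Qed.

Lemma p_extension_structure : lie_p_structure br p p_extension.
Proof.
split=> [x y|k x|x y]; last first.
- by apply: additivity_of_pder; [exact: p_extensionZ|exact: pder_p_extension].
- exact: p_extensionZ.
rewrite /p_extension !(brDl br_bilin) (brZl br_bilin) adE ad_q ?a_rest //.
rewrite -(iter_brZl br_bilin) -bracket_jacobson.
by rewrite addrC subrK.
Qed.

End Jacobson.

(** * From Hom-Lie p-structures to Lie p-structures *)

Section Untwisting.
Variables (F : fieldType) (M : lmodType F) (br : M -> M -> M) (al : M -> M).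
Hypotheses (hl : hom_lie br al)
  (br_al2 : forall x y, br (al (al x)) y = br x y)
  (al2_br : forall x y, al (al (br x y)) = br x y).

Definition untwist x y := al (br x y).

(** A double untwisted bracket is [br (al a) (br b c)], so the Hom-Jacobi identity becomes the
    Jacobi identity. *)
Lemma untwist_lie : lie_bracket untwist.
Proof.
have [br_bilin al_lin skew jac mul] := hl.
have alN x : al (- x) = - al x.
  by have := al_lin (-1) x 0; rewrite !scaleN1r addr0 => ->;
    have := al_lin (-1) 0 0; rewrite !scaleN1r oppr0 addr0 addNr => ->; rewrite addr0.
split.
- by split=> a x y z; rewrite /untwist (br_bilin.1, br_bilin.2) al_lin.
- by move=> x y; rewrite /untwist skew alN.
have ttr a b c : al (br a (al (br b c))) = br (al a) (br b c).
  by rewrite mul al2_br.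
move=> x y z; rewrite /untwist !ttr [br (al (br x y)) z]skew alN ttr.
have := jac x y z; rewrite (skew z x) (brNr br_bilin) => /eqP.
by rewrite -addrA addr_eq0 => /eqP ->; rewrite opprD opprK addrC.
Qed.

Lemma br_iter_even n x y : br (iter n.*2 al x) y = br x y.
Proof. by elim: n => //= n IHn; rewrite br_al2. Qed.

(** Two consecutive factors act as [br (al x) (br x _)], which is the square of [untwist x]. *)
Lemma adchain_even n x y :
  adchain br al x n.*2 y = iter n.*2 (untwist x) y.
Proof.
have [_ _ _ _ mul] := hl.
elim: n => //= n ->; rewrite /untwist mul al2_br !br_iter_even.
by rewrite -iterS iterSr br_iter_even.
Qed.

Lemma adchain_odd n x y : odd n ->
  al (adchain br al x n y) = iter n (untwist x) y.
Proof.
move=> n_odd; rewrite -(odd_double_half n) n_odd /= adchain_even.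
by rewrite br_iter_even.
Qed.

(** For odd p the chain in (R3) has even length and needs no correction. The one in (R1) has odd
    length and misses one [al], just as the left side does. *)
Lemma untwist_p_structure p (pm : M -> M) : odd p ->
  lie_p_structure untwist p pm -> p_structure p br al pm.
Proof.
have [_ _ skew _ _] := hl.
move=> p_odd [R1 R2 R3].
have p1 : p.-1 = (p./2).*2 by rewrite -{1}(odd_double_half p) p_odd.
split=> // [x y|x y].
  rewrite skew p1 br_iter_even -skew -al2_br -[al (br _ _)]/(untwist _ _) R1.
  rewrite -adchain_odd //; move: p_odd; case: p p1 R1 R3 {R2} => //= n.
by have [s [sE sD]] := R3 x y; exists s; split=> // k; rewrite p1 adchain_even -p1.
Qed.

End Untwisting.

(** * Computation rules for bilinear forms *)

Section Forms.
Variables (F : fieldType) (V : lmodType F) (B : V -> V -> F).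
Hypothesis B_bilin : bilin_form B.

Lemma formDl x y z : B (x + y) z = B x z + B y z.
Proof. by have := B_bilin.1 1 x y z; rewrite scale1r mul1r. Qed.

Lemma formDr x y z : B z (x + y) = B z x + B z y.
Proof. by have := B_bilin.2 1 x y z; rewrite scale1r mul1r. Qed.

Lemma form0l z : B 0 z = 0.
Proof. by apply: (addrI (B 0 z)); rewrite -formDl !addr0. Qed.

Lemma form0r z : B z 0 = 0.
Proof. by apply: (addrI (B z 0)); rewrite -formDr !addr0. Qed.

Lemma formZl a x z : B (a *: x) z = a * B x z.
Proof. by have := B_bilin.1 a x 0 z; rewrite form0l !addr0. Qed.

Lemma formZr a x z : B z (a *: x) = a * B z x.
Proof. by have := B_bilin.2 a x 0 z; rewrite form0r !addr0. Qed.

Lemma formNl x z : B (- x) z = - B x z.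
Proof. by rewrite -scaleN1r formZl mulN1r. Qed.

Lemma formNr x z : B z (- x) = - B z x.
Proof. by rewrite -scaleN1r formZr mulN1r. Qed.

Definition formE := (formDl, formDr, formZl, formZr, formNl, formNr, form0l, form0r).

End Forms.

(** * The Hom-Lie algebra L = F e* + V + F e *)

Section DoubleExtension.
Variables (F : fieldType) (V : lmodType F).
Variables (br : V -> V -> V) (al : V -> V) (B : V -> V -> F) (D : V -> V).
Variables (x0 : V) (lambda0 : F).
Hypotheses (F2 : 2%:R != 0 :> F) (hl : hom_lie br al) (inv : involutive_twist al)
  (quad : quadratic br al B) (der : hom_derivation br al D)
  (Dinv : D_invariant B D) (x0_central : in_center br x0)
  (alDx0 : al (D x0) = - D x0).

Local Notation bL := (brL br B D).
Local Notation aL := (alL al B x0 lambda0).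

Let br_bilin : bilin_map br. Proof. by case: hl. Qed.
Let skew x y : br x y = - br y x. Proof. by case: hl. Qed.
Let al_lin : lin_map al. Proof. by case: hl. Qed.
Let mul x y : al (br x y) = br (al x) (al y). Proof. by case: hl. Qed.
Let D_lin : lin_map D. Proof. by case: der. Qed.
Let D_al x : D (al x) = al (D x). Proof. by case: der. Qed.
Let D_br x y : D (br x y) = br (D x) (al y) + br (al x) (D y).
Proof. by case: der. Qed.
Let B_bilin : bilin_form B. Proof. by case: quad. Qed.
Let B_sym x y : B x y = B y x. Proof. by case: quad. Qed.
Let B_br x y z : B (br x y) z = B x (br y z). Proof. by case: quad. Qed.
Let B_al x y : B (al x) y = B x (al y). Proof. by case: quad. Qed.
Let B_D x y : B (D x) y = - B x (D y).
Proof. by apply/eqP; rewrite -addr_eq0 Dinv. Qed.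

(** Turns identities in V into scalar identities that [ring] can close. *)
Let B_inj x y : (forall z, B x z = B y z) -> x = y.
Proof.
have [_ _ nd _ _] := quad => xy; apply/eqP; rewrite -subr_eq0; apply/eqP/nd => z.
by rewrite !(formE B_bilin) xy subrr.
Qed.

Let linD f : lin_map f -> forall x y : V, f (x + y) = f x + f y.
Proof. by move=> fl x y; have := fl 1 x y; rewrite !scale1r. Qed.

Let lin0 f : lin_map f -> f 0 = 0 :> V.
Proof.
by move=> fl; have /(congr1 (fun z => z - f 0)) := linD fl 0 0;
  rewrite addr0 addrK subrr.
Qed.

Let linZ f : lin_map f -> forall (a : F) (x : V), f (a *: x) = a *: f x.
Proof. by move=> fl a x; have := fl a x 0; rewrite (lin0 fl) !addr0. Qed.

Let linN f : lin_map f -> forall x : V, f (- x) = - f x.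
Proof. by move=> fl x; rewrite -!scaleN1r (linZ fl). Qed.

Let alE := (linD al_lin, linZ al_lin, linN al_lin, lin0 al_lin).
Let DE := (linD D_lin, linZ D_lin, linN D_lin, lin0 D_lin).
Let brE := (brDl br_bilin, brDr br_bilin, brZl br_bilin, brZr br_bilin,
  brNl br_bilin, brNr br_bilin, br0l br_bilin, br0r br_bilin).
Let BE := formE B_bilin.

Let x0r y : br y x0 = 0. Proof. by rewrite skew x0_central oppr0. Qed.

Let Bx0_br y z : B x0 (br y z) = 0.
Proof. by rewrite -B_br x0_central BE. Qed.

(** Apply D to [br x0 (al y) = 0]; the term with [al x0] vanishes because [al] is surjective and
    multiplicative. *)
Let Dx0_central : in_center br (D x0).
Proof.
move=> y; have := D_br x0 (al y).
by rewrite x0_central inv DE => /eqP; rewrite eq_sym addr_eq0 => /eqP ->;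
  rewrite -[D (al y)]inv -mul x0_central alE oppr0.
Qed.

Let alx0_central : in_center br (al x0).
Proof. by move=> y; rewrite -[y]inv -mul x0_central alE. Qed.

Lemma double_extension_bilin : bilin_map bL.
Proof.
split=> k [[a u] b] [[a' u'] b'] [[c v] d].
  apply: (congr2 pair (congr2 pair _ _)); rewrite /=.
  - by rewrite scaler0 addr0.
  - apply: B_inj => z; rewrite !(DE, BE, brE).
    by rewrite -[k *: a]/(k * a); ring.
  - by rewrite !(DE, BE).
apply: (congr2 pair (congr2 pair _ _)); rewrite /=.
- by rewrite scaler0 addr0.
- apply: B_inj => z; rewrite !(DE, BE, brE).
  by rewrite -[k *: a]/(k * a); ring.
- by rewrite !(DE, BE).
Qed.

Lemma double_extension_twist_lin : lin_map aL.
Proof.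
move=> k [[a u] b] [[a' u'] b'].
apply: (congr2 pair (congr2 pair _ _)); rewrite //=.
  by rewrite !alE scalerDl scalerDr scalerA addrACA.
rewrite !(BE) -[k *: a]/(k * a) -[k *: b]/(k * b).
by rewrite -[k *: (_ : F^o)]/(k * _); ring.
Qed.

Lemma double_extension_hom_lie : hom_lie bL aL.
Proof.
have [_ _ _ jac _] := hl.
split.
- exact: double_extension_bilin.
- exact: double_extension_twist_lin.
- move=> [[a u] b] [[a' u'] b'].
  apply: (congr2 pair (congr2 pair _ _)); rewrite /=.
  + by rewrite oppr0.
  + by rewrite (skew u) opprD opprB.
  + by rewrite B_D B_sym.
- move=> [[a u] b] [[a' v] b'] [[a'' w] b''].
  apply: (congr2 pair (congr2 pair _ _)); rewrite /=.
  + by rewrite !addr0.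
  + apply: B_inj => z.
    rewrite !(brE, DE) !x0_central !D_br !(skew (D _) (al _)) !scale0r.
    have := congr1 (B^~ z) (jac u v w).
    by rewrite !(BE, brE) => J; rewrite -[RHS]J; ring.
  (* Cyclic identity for the e-component: moving D across B in the first term and applying the
     Leibniz rule gives minus the other two. *)
  + have tri : B (D (al u)) (br v w) + B (D (al v)) (br w u)
               + B (D (al w)) (br u v) = 0.
      rewrite D_al B_al mul B_D D_br !inv BE !D_al.
      by rewrite (skew (al (D v))) -[B u (br v _)]B_br !BE -B_br (skew u w) !BE
        ![B (al _) (br _ _)]B_sym; ring.
    have sA x y : B (al (D x)) (D y) = B (al (D y)) (D x) by rewrite B_al B_sym.
    move: tri; rewrite !(DE, BE) !D_al !B_al -!B_al.
    rewrite -![B (D x0) (br _ _)]B_br !Dx0_central !BE => tri.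
    rewrite (sA w u) (sA v u) (sA w v) -[RHS]tri; ring.
- move=> [[a u] b] [[a' u'] b'].
  apply: (congr2 pair (congr2 pair _ _)); rewrite //=.
  + rewrite !(alE, DE, brE) mul !x0_central x0r !D_al scaler0 !add0r.
    apply: B_inj => z; rewrite !BE; ring.
  (* D is skew for the symmetric form B, and 2 is invertible. *)
  + have sk : B (D x0) x0 = 0.
      have /eqP := B_D x0 x0; rewrite (B_sym x0) -addr_eq0 -mulr2n -mulr_natl.
      by rewrite mulf_eq0 (negPf F2) => /eqP.
    have h1 y : B (D x0) (al y) = B x0 (D y).
      by rewrite -B_al alDx0 BE B_D opprK.
    have h2 y : B (al (D y)) x0 = - B x0 (D y).
      by rewrite B_al B_D D_al alDx0 BE opprK B_sym B_D.
    rewrite !(DE, BE) Bx0_br sk !D_al h1 h2 [B (al (D u)) (al u')]B_al inv.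
    ring.
Qed.

(** The square of the twist moves e* by [x0 + al x0] up to a multiple of e. This vector is central
    in V and killed by D. *)
Lemma double_extension_br_al2 X Y : bL (aL (aL X)) Y = bL X Y.
Proof.
case: X Y => [[a u] b] [[a' u'] b'].
apply: (congr2 pair (congr2 pair _ _)); rewrite //=.
  by rewrite !(alE, DE, brE) x0_central alx0_central !inv D_al alDx0 !(scaler0, add0r)
    scalerN addrA subrr add0r.
by rewrite !(alE, DE, BE) inv D_al alDx0 !BE addrA mulrN subrr add0r.
Qed.

(** On V the square of the twist adds B(x0 + al x0, u) e, which vanishes for u in D V + [V,V]. *)
Lemma double_extension_al2_br X Y : aL (aL (bL X Y)) = bL X Y.
Proof.
case: X Y => [[a u] b] [[a' u'] b'].
apply: (congr2 pair (congr2 pair _ _)); rewrite //=.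
  by rewrite !scale0r !add0r inv.
have Bx0D y : B x0 (D y) + B x0 (al (D y)) = 0.
  rewrite -B_al -BE (B_sym _ (D y)) B_D DE D_al alDx0 subrr.
  by rewrite BE oppr0.
have Bx0D' y : B x0 (al (D y)) = - B x0 (D y).
  by apply/eqP; rewrite -addr_eq0 addrC Bx0D.
rewrite scale0r add0r !(alE, BE) mul !Bx0_br !Bx0D'; ring.
Qed.

(** * Chains of brackets in L and their adjoints for B *)

Lemma iter_twist_ker n u b :
  exists c, iter n aL ((0, u, b) : Lsp V) = (0, iter n al u, c).
Proof.
elim: n => [|n [c IHn]] /=; first by exists b.
by rewrite IHn /= scale0r add0r; eexists.
Qed.

Lemma iter_twist_estar n :
  exists2 c, in_center br c & exists d, iter n aL estar = (1, c, d).
Proof.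
elim: n => [|n [c cc [d IHn]]] /=.
  by exists 0; [move=> y; rewrite brE | exists 0].
exists (x0 + al c); last by rewrite IHn /= scale1r; eexists.
by move=> y; rewrite brE x0_central add0r -[y]inv -mul cc alE.
Qed.

(** The first bracket turns a' e* into - a' D u, and the rest of the chain acts one twist later,
    hence [al u]. As e is central, only the last bracket contributes to the e-component. *)
Lemma adchain_ker n u b (a' : F) u' b' :
  adchain bL aL (0, u, b) n.+2 (a', u', b')
  = (0, adchain br al u n.+2 u' - a' *: adchain br al (al u) n.+1 (D u),
     B (D (iter n.+1 al u))
       (adchain br al u n.+1 u' - a' *: adchain br al (al u) n (D u))).
Proof.
elim: n => [|n IHn].
  rewrite /= !scale0r !sub0r oppr0 !add0r !brE [- (a' *: br _ _) + _]addrC.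
  by congr (_, _, B _ _); rewrite addrC.
have [c alc] := iter_twist_ker n.+2 u b.
rewrite -[LHS]/(bL (iter n.+2 aL (0, u, b)) (adchain bL aL (0, u, b) n.+2 _)).
rewrite IHn alc /= !scale0r sub0r oppr0 add0r.
by congr (_, _, _); rewrite !brE -iterS iterSr.
Qed.

Lemma adchain_estar n (a : F) u b :
  exists c, adchain bL aL estar n.+1 (a, u, b) = (0, iter n.+1 D u, c).
Proof.
elim: n => [|n [c IHn]].
  by rewrite /= scale1r !(DE, brE) scaler0 subr0 addr0; eexists.
have [z zc [d alz]] := iter_twist_estar n.+1.
rewrite -[adchain _ _ _ _ _]/(bL (iter n.+1 aL estar) (adchain bL aL estar n.+1 _)).
by rewrite IHn alz /= scale1r zc scale0r subr0 addr0; eexists.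
Qed.

(** The last factor is an even twist of e*, so it acts as e* itself and produces no e-component. *)
Lemma adchain_estar_odd n (a : F) u b : odd n ->
  adchain bL aL estar n (a, u, b) = (0, iter n D u, 0).
Proof.
move=> n_odd; have nE := odd_double_half n; move: nE; rewrite n_odd => <-.
case: (n./2) => [|m].
  by rewrite /= scale1r !(DE, brE, BE) scaler0 subr0 addr0.
have [c IH] := adchain_estar m.*2.+1 a u b.
have even := br_iter_even double_extension_br_al2 m.+1 estar.
rewrite add1n.
rewrite -[LHS]/(bL (iter m.+1.*2 aL estar) (adchain bL aL estar m.+1.*2 _)).
rewrite even doubleS IH /= scale1r !(DE, brE, BE).
by rewrite scale0r subr0 addr0.
Qed.

Let iter_al_even n x : iter n.*2 al x = x.
Proof. by elim: n => //= n ->. Qed.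

Let adchainV_even n u y :
  adchain br al u n.*2 y = iter n (fun z => br (al u) (br u z)) y.
Proof. by elim: n => //= n ->; rewrite iter_al_even. Qed.

Let B_brl x y z : B (br x y) z = - B y (br x z).
Proof. by rewrite skew BE B_br. Qed.

(** Each ad is skew for B. Reversing an even number of alternating factors exchanges u and [al u],
    without a sign. *)
Lemma form_adchain_even n u x y :
  B (adchain br al (al u) n.*2 x) y = B x (adchain br al u n.*2 y).
Proof.
rewrite !adchainV_even inv; elim: n y => // n IHn y.
by rewrite [in RHS]iterSr -IHn /= !B_brl opprK.
Qed.

(** An odd alternating chain is a palindrome, hence skew for B. *)
Lemma form_adchain_odd n u x : B x (adchain br al u n.*2.+1 x) = 0.
Proof.
have adj y z : B (adchain br al u n.*2.+1 y) z = - B y (adchain br al u n.*2.+1 z).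
  rewrite /= iter_al_even !adchainV_even B_brl; congr (- _).
  elim: n y z => // n IHn y z.
  by rewrite [in RHS]iterSr -IHn /= !B_brl opprK.
have /eqP := adj x x; rewrite B_sym -addr_eq0 -mulr2n -mulr_natl.
by rewrite mulf_eq0 (negPf F2) => /eqP.
Qed.

(** * The p-map on V + F e and the p-th power of e* *)

Variables (p : nat) (pV : V -> V) (P : V -> F) (xi l m : F) (a0 u0 : V).
Hypotheses (p_odd : odd p) (p_gt2 : (2 < p)%N)
  (pVs : p_structure p br al pV) (Dres : restricted_der p br al pV D)
  (Dp : p_property p br al D xi a0)
  (u0_central : in_center br u0) (Du0 : D u0 = 0)
  (PZ : forall (g : F) u, P (g *: u) = g ^+ p * P u)
  (PD : forall u v, exists eta : nat -> F, eta_coeffs p br al B D u v eta /\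
       P (u + v) = P u + P v + \sum_(1 <= i < p) eta i)
  (frob : forall a b : F, (a + b) ^+ p = a ^+ p + b ^+ p).

Definition power_ker (X : Lsp V) : Lsp V :=
  let: (_, u, b) := X in
  (0, pV u + b ^+ p *: u0, P u + b ^+ p * m).

Definition power_estar : Lsp V := (xi, a0, l).

Let p_half : p = (p./2).*2.+1.
Proof. by rewrite -{1}(odd_double_half p) p_odd. Qed.

Let p_half1 : p.-1 = (p./2).*2. Proof. by rewrite {1}p_half. Qed.

(** This is the p-property, since the twist of V has trivial (p-1)-th power; the e-component
    vanishes by D a0 = 0. *)
Lemma ad_power_estar Y :
  untwist bL aL power_estar Y = iter p (untwist bL aL estar) Y.
Proof.
rewrite -(adchain_odd double_extension_hom_lie double_extension_br_al2
  double_extension_al2_br) //.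
case: Y => [[a u] b]; rewrite adchain_estar_odd //; congr (aL _).
have [Dpow Da0] := Dp.
rewrite Dpow p_half1 iter_al_even /power_estar /= Da0 scaler0 subr0.
by rewrite (form0l B_bilin).
Qed.

(** In the V-component, u' is handled by (R1) in V and a' by restrictedness of D. In the
    e-component, the even chain is transposed and the odd one pairs to zero. *)
Lemma ad_power_ker (X Y : Lsp V) : X.1.1 = 0 ->
  untwist bL aL (power_ker X) Y = iter p (untwist bL aL X) Y.
Proof.
case: X Y => [[_ u] b] [[a' u'] b'] /= ->.
rewrite -(adchain_odd double_extension_hom_lie double_extension_br_al2
  double_extension_al2_br) //; congr (aL _).
have pE : p = (p - 2).+2 by lia.
have p1E : (p - 2).+1 = (p./2).*2 by lia.
have p2E : (p - 2)%N = (p./2).-1.*2.+1 by lia.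
have [R1 _ _] := pVs.
have R1u : br (pV u) u' = adchain br al u p u'.
  by rewrite -R1 p_half1 iter_al_even.
have Dpu : D (pV u) = adchain br al (al u) p.-1 (D u) by exact: Dres.
rewrite [in RHS]pE adchain_ker -pE p1E iter_al_even p2E.
rewrite -p_half1 [LHS]/= scale0r sub0r !(DE, brE) Du0 scaler0 addr0.
rewrite u0_central scaler0 addr0.
rewrite R1u Dpu; congr (_, _, _); first by rewrite addrC.
rewrite (formDr B_bilin) (formNr B_bilin) (formZr B_bilin) form_adchain_odd.
by rewrite mulr0 subr0 p_half1 form_adchain_even.
Qed.

Lemma power_kerZ (k : F) (X : Lsp V) : X.1.1 = 0 ->
  power_ker (k *: X) = k ^+ p *: power_ker X.
Proof.
case: X => [[a u] b] _; have [_ R2 _] := pVs.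
apply: (congr2 pair (congr2 pair _ _)); rewrite /=.
- by rewrite scaler0.
- by rewrite R2 scalerDr scalerA -exprMn.
- by rewrite PZ -[k *: b]/(k * b) exprMn -[_ *: (_ : F^o)]/(_ * _) mulrDr mulrA.
Qed.

Let sum_triple (r : seq nat) (f : nat -> V) (g : nat -> F) :
  \sum_(i <- r) ((0, f i, g i) : Lsp V)
  = (0, \sum_(i <- r) f i, \sum_(i <- r) g i).
Proof.
elim: r => [|i r IHr]; first by rewrite !big_nil.
by rewrite !big_cons IHr; congr (_, _, _); exact: addr0.
Qed.

(** The identity defining the eta_i is the e-component of the chain in (R3), so s_i has components
    (0, s_i(u,v), eta_i(u,v)). *)
Lemma power_kerD (X Y : Lsp V) : X.1.1 = 0 -> Y.1.1 = 0 -> exists s : nat -> Lsp V,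
  (forall k : F, iter p.-1 (untwist bL aL (k *: X + Y)) X
                 = \sum_(1 <= i < p) k ^+ i.-1 *: (s i *+ i))
  /\ power_ker (X + Y) = power_ker X + power_ker Y + \sum_(1 <= i < p) s i.
Proof.
case: X Y => [[_ u] b] [[_ v] c] /= -> ->; have [_ _ R3] := pVs.
have [s [sE sD]] := R3 u v; have [eta [etaE etaD]] := PD u v.
exists (fun i => (0, s i, eta i)); split=> [k|]; last first.
  rewrite sum_triple; apply: (congr2 pair (congr2 pair _ _)); rewrite /=.
  - by rewrite !addr0.
  - rewrite sD frob scalerDl [LHS]addrAC; congr (_ + _).
    by rewrite addrACA.
  - by rewrite etaD frob; ring.
rewrite p_half1 -(adchain_even double_extension_hom_lie double_extension_br_al2
  double_extension_al2_br) -p_half1.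
have -> : k *: ((0, u, b) : Lsp V) + (0, v, c) = (0, k *: u + v, k *: b + c).
  by apply: (congr2 pair (congr2 pair _ _)); rewrite //= scaler0 addr0.
have pE : p.-1 = (p - 3).+2 by lia.
have pE2 : (p - 3).+1 = p.-2 by lia.
rewrite pE adchain_ker -pE pE2 !scale0r !subr0 sE etaE.
transitivity ((0, \sum_(1 <= i < p) k ^+ i.-1 *: (s i *+ i),
   \sum_(1 <= i < p) eta i *+ i * k ^+ i.-1) : Lsp V) => //.
rewrite -sum_triple; apply: eq_bigr => i _.
have mulrn_triple j :
    ((0, s i, eta i) : Lsp V) *+ j = (0, s i *+ j, eta i *+ j).
  elim: j => // j IHj; rewrite !mulrS IHj.
  by apply: (congr2 pair (congr2 pair _ _)); rewrite //= addr0.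
rewrite mulrn_triple.
by apply: (congr2 pair (congr2 pair _ _)); rewrite /= ?scaler0 // mulrC.
Qed.

End DoubleExtension.

Theorem theorem4p4 (F : closedFieldType) (p : nat) (V : lmodType F)
  (brV : V -> V -> V) (alV : V -> V) (BV : V -> V -> F) (pV : V -> V)
  (D : V -> V) (xi : F) (a0 : V) (x0 : V) (lambda0 : F)
  (l m : F) (u0 : V) (P : V -> F) :
  p \in [pchar F] -> (2 < p)%N ->
  hom_lie brV alV -> involutive_twist alV -> quadratic brV alV BV ->
  p_structure p brV alV pV ->
  hom_derivation brV alV D -> restricted_der p brV alV pV D ->
  p_property p brV alV D xi a0 -> D_invariant BV D ->
  (forall x, 1 *: D x + brV x0 x = D x) ->
  alV (D x0) = - D x0 ->
  (forall x, alV (D (D x)) - D (D (alV x)) = brV (D x0) x) ->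
  in_center brV u0 -> D u0 = 0 ->
  (forall (g : F) u, P (g *: u) = g ^+ p * P u) ->
  (forall u v, exists eta : nat -> F, eta_coeffs p brV alV BV D u v eta /\
       P (u + v) = P u + P v + \sum_(1 <= i < p) eta i) ->
  exists pL : Lsp V -> Lsp V,
    [/\ p_structure p (brL brV BV D) (alL alV BV x0 lambda0) pL,
        (forall u, pL (incV u) = incV (pV u) + P u *: eL),
        pL estar = incV a0 + l *: eL + xi *: estar
      & pL eL = m *: eL + incV u0].
Proof.
move=> chF p_gt2 hl inv quad pVs der Dres Dp Dinv x0D alDx0 _ u0c Du0 PZ PD.
have p_pr := pcharf_prime chF.
have p_gt0 : (0 < p)%N by exact: prime_gt0.
have p_odd : odd p by case: (even_prime p_pr) p_gt2 => [->|].
have F2 : 2%:R != 0 :> F by rewrite -(dvdn_pcharf chF) gtnNdvd.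
(* With lambda = 1 the first condition on x0 says ad(x0) = 0. *)
have x0c : in_center brV x0.
  move=> x; have := x0D x; rewrite scale1r => /(canRL (addKr _)) ->.
  exact: addNr.
have frob (a b : F) : (a + b) ^+ p = a ^+ p + b ^+ p.
  by have := pFrobenius_autD_comm chF (mulrC a b); rewrite !pFrobenius_autE.
have hlL := double_extension_hom_lie lambda0 F2 hl inv quad der Dinv x0c alDx0.
have br_al2 := double_extension_br_al2 lambda0 hl inv quad der x0c alDx0.
have al2_br := double_extension_al2_br lambda0 hl inv quad der Dinv x0c alDx0.
have lieL := untwist_lie hlL al2_br.
pose q := power_ker p pV P m u0.
pose bL := untwist (brL brV BV D) (alL alV BV x0 lambda0).
pose a (X : Lsp V) : F := X.1.1.
have aE : a estar = 1 by [].
have a_lin (k : F) X Y : a (k *: X + Y) = k * a X + a Y by [].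
have ad_estar := ad_power_estar lambda0 F2 hl inv quad der Dinv x0c alDx0 l p_odd Dp.
have ad_q := ad_power_ker lambda0 F2 hl inv quad der Dinv x0c alDx0 P m p_odd p_gt2
  pVs Dres u0c Du0.
have qZ := power_kerZ m u0 pVs PZ.
have qD := power_kerD lambda0 F2 hl inv quad der Dinv x0c alDx0 m u0 p_odd p_gt2
  pVs PD frob.
exists (p_extension bL p a estar (power_estar xi l a0) q); split.
- apply: (untwist_p_structure hlL br_al2 al2_br p_odd).
  apply: (p_extension_structure lieL chF p_gt2 a_lin aE ad_estar _ qZ qD).
  by move=> X aX Y; exact: ad_q.
- move=> u; rewrite (p_extension_ker lieL p_gt2) //.
  apply: (congr2 pair (congr2 pair _ _)); rewrite /= ?expr0n ?eqn0Ngt ?p_gt0.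
  + by rewrite scaler0 addr0.
  + by rewrite scale0r scaler0.
  + by rewrite mul0r addr0 add0r -[P u *: _]/(P u * _) mulr1.
- rewrite (p_extension_gen lieL chF p_gt2 _ a_lin aE qZ).
  apply: (congr2 pair (congr2 pair _ _)); rewrite /= ?scaler0 ?addr0 ?add0r //.
  + by rewrite -[xi *: _]/(xi * _) mulr1.
  + by rewrite -[l *: _]/(l * _) mulr1.
- rewrite (p_extension_ker lieL p_gt2) //.
  have [_ R2 _] := pVs.
  have pV0 : pV 0 = 0.
    by have := R2 0 0; rewrite expr0n eqn0Ngt p_gt0 !scale0r.
  have P0 : P 0 = 0.
    by have := PZ 0 0; rewrite expr0n eqn0Ngt p_gt0 scale0r mul0r.
  apply: (congr2 pair (congr2 pair _ _)); rewrite /= ?pV0 ?P0 ?expr1n.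
  + by rewrite scaler0 addr0.
  + by rewrite scale1r scaler0.
  + by rewrite mul1r add0r addr0 -[m *: _]/(m * _) mulr1.
Qed.
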